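(* Define $$\epsilon_4=\frac{71}{3888},\qquad \epsilon_n=\frac1{2n}-\frac{n}{(n-1)\bigl(2(n-2)^2-n\bigr)}\quad\text{for integers } n\ge 5.$$ Then $\epsilon_n>0$ for every integer $n\ge 4$, and for every integer $n\ge 4$ and every $n\times n$ doubly stochastic matrix $A$, $$\operatorname{per}A-\operatorname{per}\tau_n(A)\ \ge\ \frac{n!}{n^n}\,\epsilon_n\,\|A-J_n\|_F^2 .$$
   Context: For an $n\times n$ matrix $D=(d_{ij})$, the permanent is $\operatorname{per}D=\sum_{\pi\in S_n}\prod_{i=1}^n d_{i,\pi(i)}$, where $S_n$ is the set of all permutations of $\{1,\dots,n\}$. A real matrix is doubly stochastic if its entries are nonnegative and every row sum and every column sum equals $1$. $J_n$ is the $n\times n$ matrix with every entry $1/n$. The Marcus--Minc transform is $\tau_n(A)=(nJ_n-A)/(n-1)$. The Frobenius norm of $X=(x_{ij})$ is $\|X\|_F=\bigl(\sum_{i,j}x_{ij}^2\bigr)^{1/2}$. *)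

(* Defs.v *)
From mathcomp Require Import all_boot all_order all_fingroup all_algebra.
From mathcomp Require Import reals.

Set Implicit Arguments.
Unset Strict Implicit.
Unset Printing Implicit Defensive.

Import Order.TTheory GRing.Theory Num.Theory.
Local Open Scope ring_scope.

Definition permanent (R : comPzRingType) (n : nat) (D : 'M[R]_n) : R :=
  \sum_(s : 'S_n) \prod_(i < n) D i (s i).

Definition doubly_stochastic (R : realType) (n : nat) (A : 'M[R]_n) : Prop :=
  [/\ forall i j, 0 <= A i j,
      forall i, \sum_(j < n) A i j = 1
    & forall j, \sum_(i < n) A i j = 1].

Definition flat_mx (R : realType) (n : nat) : 'M[R]_n := const_mx (1 / n%:R).

(* The Marcus-Minc transform (n J_n - A) / (n - 1). *)
Definition marcus_minc (R : realType) (n : nat) (A : 'M[R]_n) : 'M[R]_n :=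
  (n%:R - 1)^-1 *: (n%:R *: flat_mx R n - A).

Definition frobenius_norm (R : realType) (m n : nat) (X : 'M[R]_(m, n)) : R :=
  Num.sqrt (\sum_(i < m) \sum_(j < n) X i j ^+ 2).

(* Only meaningful for n >= 4. *)
Definition epsilon (R : realType) (n : nat) : R :=
  if n == 4%N then 71 / 3888
  else 1 / (2 * n%:R)
       - n%:R / ((n%:R - 1) * (2 * (n%:R - 2) ^+ 2 - n%:R)).

(* Main.v *)
Require Import Defs.
From mathcomp Require Import all_boot all_order all_fingroup all_algebra.
From mathcomp Require Import reals.
From mathcomp Require Import ring lra zify complex.

Set Implicit Arguments.
Unset Strict Implicit.
Unset Printing Implicit Defensive.

Import Order.TTheory GRing.Theory Num.Theory.
Local Open Scope ring_scope.

(** Write A = J + X and n! per M as the sum over s, t in S_n of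
    prod_i M (s i) (t i), a quadratic form in the n-fold Kronecker power of M.

    Upper bound for per (J - X / (n-1)): expanding the power of J + tX over the
    set S of sites that carry X, Cauchy-Schwarz and the fact that A is an
    l2-contraction bound the S-term by ||X||^2 / (n-1) times the same term for
    I - J in place of X, as soon as |S| >= 2; the reduced correlation matrix of
    a single site is a multiple of I - J because S_n is 2-transitive.  What
    remains is the permanent of a combination of J and I, a truncated
    exponential series.

    Lower bound for per A: expand along one column c.  The polynomial
    q = sum_i c_i prod_(k != i) (A' x)_k has capacity at least
    prod_k (1 - c_k)^(1 - c_k) by two applications of Jensen's inequality, and
    Gurvits' argument for H-stable polynomials eliminates the remaining
    variables.  Convexity of (1 - c) ln (1 - c) turns this into a gain
    proportional to ||c - 1/n||^2, and the average over all columns gives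
    ||X||^2. *)

(** * The upper bound *)

Section MixedSum.
Variables (R : realType) (n : nat).
Implicit Types (M N : 'I_n -> 'M[R]_n) (f g : {ffun 'I_n -> 'I_n}).

(** The quadratic form of the Kronecker product of the [M i] at the indicator vector of the
    bijections among all maps from ['I_n] to itself; [tensor] below is the image of that vector. *)
Definition mixed_sum M : R :=
  \sum_(s : 'S_n) \sum_(t : 'S_n) \prod_i M i (s i) (t i).

Definition tensor M f : R := \sum_(t : 'S_n) \prod_i M i (f i) (t i).

Lemma eq_mixed_sum M N : (forall i, M i = N i) -> mixed_sum M = mixed_sum N.
Proof.
move=> MN; apply: eq_bigr => s _; apply: eq_bigr => t _.
by apply: eq_bigr => i _; rewrite MN.
Qed.

Lemma mixed_sum_const (A : 'M[R]_n) :
  mixed_sum (fun=> A) = n`!%:R * permanent A.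
Proof.
rewrite /mixed_sum /permanent mulr_natl -[in RHS]card_Sn -sumr_const.
apply: eq_big => [s|s _]; first by rewrite inE.
rewrite (reindex_inj (mulgI s)); apply: eq_bigr => t _ /=.
rewrite [RHS](reindex_inj (@perm_inj _ s)); apply: eq_bigr => i _.
by rewrite permM.
Qed.

Lemma tensor_dot M N :
  \sum_f tensor M f * tensor N f = mixed_sum (fun i => (M i)^T *m N i).
Proof.
rewrite /mixed_sum /tensor.
under eq_bigr => f _.
  rewrite mulr_suml; under eq_bigr => s _ do rewrite mulr_sumr.
  over.
rewrite exchange_big; apply: eq_bigr => s _ /=.
rewrite exchange_big; apply: eq_bigr => t _ /=.
under [RHS]eq_bigr => i _ do rewrite mxE.
rewrite bigA_distr_bigA; apply: eq_bigr => f _ /=.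
by rewrite -big_split; apply: eq_bigr => i _; rewrite mxE.
Qed.

Lemma tensor_mulmx (D : 'I_n -> 'M[R]_n) N f :
  tensor (fun i => D i *m N i) f
    = \sum_(g : {ffun 'I_n -> 'I_n}) (\prod_i D i (f i) (g i)) * tensor N g.
Proof.
rewrite /tensor; under [RHS]eq_bigr => g _ do rewrite mulr_sumr.
rewrite exchange_big; apply: eq_bigr => t _ /=.
under eq_bigr => i _ do rewrite mxE.
rewrite bigA_distr_bigA; apply: eq_bigr => g _ /=.
by rewrite -big_split.
Qed.

(** The variance of [u] under the weights [p] is nonnegative. *)
Lemma sqr_sum_le (I : finType) (p u : I -> R) :
  (forall i, 0 <= p i) -> \sum_i p i = 1 ->
  (\sum_i p i * u i) ^+ 2 <= \sum_i p i * u i ^+ 2.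
Proof.
move=> p0 p1; set m := \sum_i p i * u i.
have : 0 <= \sum_i p i * (u i - m) ^+ 2.
  by apply: sumr_ge0 => i _; rewrite mulr_ge0 ?sqr_ge0.
have E i : p i * (u i - m) ^+ 2
    = p i * u i ^+ 2 - (m *+ 2) * (p i * u i) + m ^+ 2 * p i by ring.
rewrite (eq_bigr _ (fun i _ => E i)).
rewrite !big_split /= sumrN -!mulr_sumr p1 -/m; nra.
Qed.

(* A Kronecker product of doubly stochastic matrices is doubly stochastic,
   hence an l2-contraction. *)
Lemma tensor_contraction (D : 'I_n -> 'M[R]_n) N :
  (forall i, doubly_stochastic (D i)) ->
  \sum_f tensor (fun i => D i *m N i) f ^+ 2 <= \sum_f tensor N f ^+ 2.
Proof.
move=> dsD.
have jensen f : tensor (fun i => D i *m N i) f ^+ 2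
    <= \sum_(g : {ffun 'I_n -> 'I_n})
         (\prod_i D i (f i) (g i)) * tensor N g ^+ 2.
  rewrite tensor_mulmx; apply: sqr_sum_le.
    by move=> g; apply: prodr_ge0 => i _; case: (dsD i).
  rewrite -(bigA_distr_bigA (fun i j => D i (f i) j)).
  by apply: big1 => i _; case: (dsD i).
apply: le_trans (ler_sum _ (fun f _ => jensen f)) _.
rewrite exchange_big; apply: ler_sum => g _ /=.
rewrite -mulr_suml -(bigA_distr_bigA (fun i j => D i j (g i))).
by rewrite big1 ?mul1r // => i _; case: (dsD i).
Qed.

Definition perm_invariant (A : 'M[R]_n) :=
  forall (s : 'S_n) x y, A (s x) (s y) = A x y.

Lemma two_transitive (x y x' y' : 'I_n) :
  x != y -> x' != y' -> exists s : 'S_n, s x = x' /\ s y = y'.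
Proof.
move=> xy xy'; pose z := tperm x x' y.
have zx' : z != x'.
  by rewrite /z -{2}(tpermL x x') (inj_eq perm_inj) eq_sym.
(* The second transposition leaves [x'] in place, since both [z] and [y'] differ from it. *)
exists (tperm x x' * tperm z y')%g.
by rewrite !permM tpermL -/z tpermL tpermD // eq_sym.
Qed.

Section OneSite.
Variables (b : 'I_n) (W : 'I_n -> 'M[R]_n).
Hypothesis Winv : forall i, perm_invariant (W i).

Let corr (x y : 'I_n) : R :=
  \sum_(s : 'S_n | s b == x) \sum_(t : 'S_n | t b == y)
    \prod_(i | i != b) W i (s i) (t i).

Let mixed_sum_site (Z : 'M[R]_n) :
  mixed_sum (fun i => if i == b then Z else W i)
    = \sum_x \sum_y Z x y * corr x y.
Proof.
rewrite /mixed_sum (partition_big (fun s : 'S_n => s b) xpredT) //=.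
apply: eq_bigr => x _; rewrite /corr.
under [RHS]eq_bigr => y _ do rewrite mulr_sumr.
rewrite [RHS]exchange_big; apply: eq_bigr => s /eqP sx /=.
rewrite (partition_big (fun s : 'S_n => s b) xpredT) //=.
apply: eq_bigr => y _; rewrite mulr_sumr; apply: eq_bigr => t /eqP ty.
rewrite (bigD1 b) //= eqxx sx ty; congr (_ * _).
by apply: eq_bigr => i /negbTE ->.
Qed.

(** Composing [s] and [t] with [s0] permutes the terms, and every [W i] is unchanged by a
    simultaneous relabelling of rows and columns. *)
Let corr_perm (s0 : 'S_n) x y : corr (s0 x) (s0 y) = corr x y.
Proof.
rewrite /corr (reindex_inj (mulIg s0)) /=.
apply: eq_big => [s|s _]; first by rewrite permM (inj_eq perm_inj).
rewrite (reindex_inj (mulIg s0)) /=.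
apply: eq_big => [t|t _]; first by rewrite permM (inj_eq perm_inj).
by apply: eq_bigr => i _; rewrite !permM Winv.
Qed.

(* By 2-transitivity the correlation kernel of a site has only one value on
   the diagonal and one off it. *)
Lemma mixed_sum_trace (Z Z' : 'M[R]_n) :
  \sum_x \sum_y Z x y = 0 -> \sum_x \sum_y Z' x y = 0 ->
  \tr Z' * mixed_sum (fun i => if i == b then Z else W i)
    = \tr Z * mixed_sum (fun i => if i == b then Z' else W i).
Proof.
have [r [r' rE]] : exists r r', forall x y, corr x y = if x == y then r else r'.
  exists (corr b b).
  have diag x : corr x x = corr b b.
    by rewrite -(corr_perm (tperm x b)) tpermL.
  case: (pickP [pred c | c != b]) => [c /= cb | nob].
    exists (corr c b) => x y; case: eqVneq => [->|xy] //.
    by have [s [<- <-]] := two_transitive cb xy.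
  (* Here [b] is the only index, so the off-diagonal value is arbitrary. *)
  exists 0 => x y; case: eqVneq => [->|] //.
  by move: (nob x) (nob y) => /= /negbFE/eqP -> /negbFE/eqP ->; rewrite eqxx.
have key (U : 'M[R]_n) : \sum_x \sum_y U x y = 0 ->
    mixed_sum (fun i => if i == b then U else W i) = (r - r') * \tr U.
  move=> U0; rewrite mixed_sum_site.
  transitivity (\sum_x \sum_y (r' * U x y + (r - r') * (U x y *+ (x == y)))).
    apply: eq_bigr => x _; apply: eq_bigr => y _; rewrite rE.
    by case: eqP => _; rewrite ?mulr1n ?mulr0n; ring.
  under eq_bigr => x _ do rewrite big_split -!mulr_sumr /=.
  rewrite big_split -!mulr_sumr /= U0 mulr0 add0r; congr (_ * _).
  apply: eq_bigr => x _; rewrite (bigD1 x) //= eqxx big1 ?addr0 // => y.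
  by rewrite eq_sym => /negbTE ->.
by move=> Z0 Z'0; rewrite !key //; ring.
Qed.

End OneSite.

End MixedSum.

(** * Comparison of [A - J] with the projection [I - J] *)

Section UpperBound.
Variables (R : realType) (n : nat).
Hypothesis n_gt1 : (1 < n)%N.
Let n_neq0 : n%:R != 0 :> R. Proof. by rewrite pnatr_eq0; case: n n_gt1. Qed.

Local Notation J := (flat_mx R n).
Let P : 'M[R]_n := 1%:M - J.

Let J_inv : perm_invariant J. Proof. by move=> s x y; rewrite !mxE. Qed.
Let P_inv : perm_invariant P.
Proof. by move=> s x y; rewrite !mxE (inj_eq perm_inj). Qed.

Let mulmx_flat (B : 'M[R]_n) i j : (B *m J) i j = (\sum_k B i k) / n%:R.
Proof. by rewrite mxE mulr_suml; apply: eq_bigr => k _; rewrite mxE mul1r. Qed.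

Let trJ : J^T = J. Proof. by apply/matrixP => i j; rewrite !mxE. Qed.
Let trP : P^T = P. Proof. by rewrite linearB /= trmx1 trJ. Qed.

Let sumJ i : \sum_k J i k = 1.
Proof.
under eq_bigr => k _ do rewrite mxE.
by rewrite sumr_const card_ord -(mulr_natl (1 / _)) mul1r divff.
Qed.

Let JJ : J *m J = J.
Proof. by apply/matrixP => i j; rewrite mulmx_flat sumJ mxE. Qed.

Let PP : P *m P = P.
Proof. by rewrite mulmxBl mul1mx mulmxBr mulmx1 JJ subrr subr0. Qed.

Let trace_P : \tr P = n%:R - 1.
Proof.
rewrite linearB /= mxtrace1; congr (_ - _); rewrite -(sumJ (Ordinal n_gt1)).
by apply: eq_bigr => i _; rewrite !mxE.
Qed.

Let sum_entries0 (B : 'M[R]_n) : B *m J = 0 -> \sum_x \sum_y B x y = 0.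
Proof.
move=> BJ; apply: big1 => x _; have /matrixP/(_ x x) := BJ.
by rewrite mulmx_flat mxE => /eqP; rewrite mulf_eq0 invr_eq0 (negbTE n_neq0)
  orbF => /eqP.
Qed.

Let PJ : P *m J = 0. Proof. by rewrite mulmxBl mul1mx JJ subrr. Qed.

Definition partial_sum (Z : 'M[R]_n) (S : {set 'I_n}) : R :=
  mixed_sum (fun i => if i \in S then Z else J).

Lemma mixed_sum_expand (Z : 'M[R]_n) (t : R) :
  n`!%:R * permanent (J + t *: Z)
    = \sum_(S : {set 'I_n}) t ^+ #|S| * partial_sum Z S.
Proof.
rewrite -mixed_sum_const /mixed_sum /partial_sum.
under [RHS]eq_bigr => S _ do rewrite mulr_sumr.
rewrite [RHS]exchange_big; apply: eq_bigr => s _ /=.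
under [RHS]eq_bigr => S _ do rewrite mulr_sumr.
rewrite [RHS]exchange_big; apply: eq_bigr => u _ /=.
under eq_bigr => i _ do rewrite !mxE addrC.
rewrite bigA_distr; apply: eq_bigr => S _ /=.
transitivity ((\prod_(i in S) t) *
   \prod_i (if i \in S then Z else J) (s i) (u i)); last by rewrite prodr_const.
rewrite (big_mkcond (mem S)) -big_split; apply: eq_bigr => i _ /=.
by case: ifP => _ //; rewrite !mxE !mul1r.
Qed.

Lemma partial_sum0 (Z : 'M[R]_n) : partial_sum Z set0 = n`!%:R * permanent J.
Proof.
rewrite -mixed_sum_const; apply: eq_mixed_sum => i; by rewrite inE.
Qed.

(** The product depends on [t] only through [t b], which takes each value equally often; the sum
    over [t] is thus a multiple of a row sum of [Z]. *)
Lemma partial_sum1 (Z : 'M[R]_n) b : Z *m J = 0 -> partial_sum Z [set b] = 0.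
Proof.
move=> ZJ; apply: big1 => s _.
have fiber y :
    \sum_(t : 'S_n | t b == y) (1 : R) = \sum_(t : 'S_n | t b == b) 1.
  rewrite (reindex_inj (mulIg (tperm b y))); apply: eq_bigl => t /=.
  by rewrite permM -{2}(tpermL b y) (inj_eq perm_inj).
transitivity (\sum_(t : 'S_n) Z (s b) (t b) * (1 / n%:R) ^+ n.-1).
  apply: eq_bigr => t _; rewrite (bigD1 b) //= set11; congr (_ * _).
  have -> : n.-1 = #|predC1 b| by rewrite cardC1 card_ord.
  rewrite -prodr_const; apply: eq_big => [i|i ib]; first by rewrite !inE.
  by rewrite inE (negbTE ib) mxE.
rewrite -mulr_suml (partition_big (fun t : 'S_n => t b) xpredT) //=.
under eq_bigr => y _.
  under eq_bigr => t /eqP -> do rewrite -[Z _ _]mulr1.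
  rewrite -mulr_sumr fiber; over.
rewrite -mulr_suml /=.
have /matrixP/(_ (s b) b) := ZJ; rewrite mulmx_flat mxE => /eqP.
rewrite mulf_eq0 invr_eq0 (negbTE n_neq0) orbF => /eqP ->.
by rewrite !mul0r.
Qed.

Variable A : 'M[R]_n.
Hypothesis dsA : doubly_stochastic A.
Let X := A - J.
(** The quotient of the squared Frobenius norms of [X] and [P], because [P] is a symmetric
    idempotent of trace [n - 1]. *)
Let ratio : R := (\sum_i \sum_j X i j ^+ 2) / (n%:R - 1).

Let AJ : A *m J = J.
Proof.
by apply/matrixP => i j; rewrite mulmx_flat; case: dsA => _ -> _; rewrite mxE.
Qed.

Let JA : J *m A = J.
Proof.
apply: trmx_inj; rewrite trmx_mul trJ; apply/matrixP => i j.
rewrite mulmx_flat; under eq_bigr => k _ do rewrite mxE.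
by case: dsA => _ _ ->; rewrite mxE.
Qed.

Let XJ : X *m J = 0. Proof. by rewrite mulmxBl AJ JJ subrr. Qed.
Let JX : J *m X = 0. Proof. by rewrite mulmxBr JA JJ subrr. Qed.
Let XP : X *m P = X. Proof. by rewrite mulmxBr mulmx1 XJ subr0. Qed.
Let PX : P *m X = X. Proof. by rewrite mulmxBl mul1mx JX subr0. Qed.
(** Between two copies of [P] the doubly stochastic [A] can stand in for [X]. *)
Let PAP : P *m (A *m P) = X.
Proof.
by rewrite mulmxBr mulmx1 AJ mulmxBl mul1mx mulmxBr JA JJ subrr subr0.
Qed.

Let n1_gt0 : 0 < n%:R - 1 :> R. Proof. by rewrite subr_gt0 ltr1n. Qed.

Let dot_gram : \tr (X^T *m X) = ratio * (n%:R - 1).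
Proof.
rewrite /ratio divfK ?gt_eqF // exchange_big; apply: eq_bigr => j _ /=.
by rewrite mxE; apply: eq_bigr => i _; rewrite mxE expr2.
Qed.

Let dot_gram' : \tr (X *m X^T) = ratio * (n%:R - 1).
Proof. by rewrite mxtrace_mulC dot_gram. Qed.

Section TwoSites.
Variables (S : {set 'I_n}) (a b : 'I_n).
Hypotheses (aS : a \in S) (bS : b \in S) (ab : a != b).

Let W (i : 'I_n) := if i \in S then P else J.

Let W_inv i : perm_invariant (W i).
Proof. by rewrite /W; case: ifP. Qed.

Let W_idem i : (W i)^T *m W i = W i.
Proof. by rewrite /W; case: ifP; rewrite ?trP ?trJ ?PP ?JJ. Qed.

(** Squaring puts [Z^T *m Z] on the site [c] and leaves the symmetric idempotents [W i] as they are;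
    [mixed_sum_trace] then trades it for [P] at the price of the quotient of traces. *)
Let site_norm c (Z : 'M[R]_n) : c \in S ->
  Z^T *m Z *m J = 0 -> \tr (Z^T *m Z) = ratio * (n%:R - 1) ->
  \sum_f tensor (fun i => if i == c then Z else W i) f ^+ 2
    = ratio * partial_sum P S.
Proof.
move=> cS ZJ trZ.
under eq_bigr => f _ do rewrite expr2.
rewrite tensor_dot.
rewrite (@eq_mixed_sum _ _ _ (fun i => if i == c then Z^T *m Z else W i));
  last by move=> i; case: ifP.
apply: (@mulfI _ (n%:R - 1)); first by rewrite gt_eqF.
rewrite -trace_P.
rewrite (mixed_sum_trace c W_inv) ?sum_entries0 // trZ trace_P.
rewrite [RHS]mulrA [X in _ = X * _]mulrC; congr (_ * _).
by apply: eq_mixed_sum => i; rewrite /W; case: eqP => // ->; rewrite cS.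
Qed.

(* Put one factor X on the site a, another on b and use A for X on the
   remaining sites of S, where it acts as a contraction. *)
Lemma partial_sum_bound : `|partial_sum X S| <= ratio * partial_sum P S.
Proof.
pose N1 i := if i == a then X^T else W i.
pose N0 i := if i == b then X else W i.
pose D i : 'M[R]_n := if [&& i \in S, i != a & i != b] then A else 1%:M.
have factor : partial_sum X S
    = \sum_f tensor N1 f * tensor (fun i => D i *m N0 i) f.
  rewrite tensor_dot; apply: eq_mixed_sum => i; rewrite /N1 /N0 /D /W.
  have [->|ia] := eqVneq i a.
    by rewrite aS (negbTE ab) trmxK mul1mx XP.
  have [->|ib] := eqVneq i b.
    by rewrite bS /= trP mul1mx PX.
  by case: ifP => _ /=; rewrite ?trP ?PAP // trJ mul1mx JJ.
have D_ds i : doubly_stochastic (D i).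
  rewrite /D; case: ifP => _ //; split=> [x y|x|y].
  - by rewrite mxE ler0n.
  - by rewrite (bigD1 x) //= mxE eqxx big1 ?addr0 // => y;
      rewrite eq_sym mxE => /negbTE ->.
  - by rewrite (bigD1 y) //= mxE eqxx big1 ?addr0 // => x;
      rewrite mxE => /negbTE ->.
have n1 : \sum_f tensor N1 f ^+ 2 = ratio * partial_sum P S.
  apply: site_norm => //; rewrite trmxK; last exact: dot_gram'.
  by rewrite -mulmxA -trJ -trmx_mul JX trmx0 mulmx0.
have n2 : \sum_f tensor (fun i => D i *m N0 i) f ^+ 2
    <= ratio * partial_sum P S.
  apply: le_trans (tensor_contraction _ D_ds) _.
  by rewrite site_norm // -mulmxA XJ mulmx0.
rewrite factor; apply: le_trans (ler_norm_sum _ _ _) _.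
(* Both squared norms have the same bound, so this gives what Cauchy-Schwarz would, without square
   roots. *)
have amgm (u v : R) : `|u * v| <= 2^-1 * u ^+ 2 + 2^-1 * v ^+ 2.
  have := sqr_ge0 (u + v); have := sqr_ge0 (u - v).
  by rewrite ler_norml sqrrB sqrrD => h1 h2; apply/andP; split; lra.
apply: le_trans (ler_sum _ (fun f _ => amgm _ _)) _.
rewrite big_split -!mulr_sumr /= n1; lra.
Qed.

End TwoSites.

(** The empty set gives the same on both sides, as the weights [1 - q] and [q] add up to 1;
    singletons give nothing, and larger sets compare term by term. *)
Lemma permanent_flat_shift_le (t : R)
    (q := (\sum_i \sum_j (A - J) i j ^+ 2) / (n%:R - 1)) :
  permanent (J + t *: (A - J))
    <= (1 - q) * permanent J + q * permanent (J + `|t| *: (1%:M - J)).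
Proof.
rewrite -/X -/P (_ : q = ratio) //.
have nf : 0 < n`!%:R :> R by rewrite ltr0n fact_gt0.
suff : n`!%:R * permanent (J + t *: X) <= (1 - ratio) * (n`!%:R * permanent J)
    + ratio * (n`!%:R * permanent (J + `|t| *: P)).
  move: nf; move: (n`!%:R : R) => F F0 h; rewrite -(ler_pM2l F0) mulrDr.
  by rewrite [F * (_ * _)]mulrCA [F * (ratio * _)]mulrCA.
rewrite (mixed_sum_expand X t) (mixed_sum_expand P `|t|).
rewrite (bigD1 set0) //= [in X in _ <= _ + X](bigD1 set0) //= cards0 !expr0.
rewrite (partial_sum0 X) (partial_sum0 P).
move: (n`!%:R * permanent J) => F.
rewrite !mul1r mulrDr addrA -mulrDl subrK mul1r lerD2l mulr_sumr.
apply: ler_sum => S S0; have /set0Pn [a aS] := S0.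
have [S1|] := eqVneq (S :\ a) set0.
  have -> : S = [set a].
    by rewrite -(setD1K aS) S1 setU0.
  by rewrite !partial_sum1 // !mulr0.
case/set0Pn => b; rewrite !inE => /andP [ba bS].
rewrite eq_sym in ba.
apply: le_trans (ler_norm _) _; rewrite normrM normrX mulrCA.
by rewrite ler_wpM2l ?exprn_ge0 // (partial_sum_bound aS bS).
Qed.

End UpperBound.

(** Let [S] be the rows that take their [b] term: the permutation must fix [S] pointwise, and
    summing over all [S] of size [k] gives the factor C(n,k) (n-k)! = n!/k!. *)
Lemma permanent_flat_identity (R : realType) (n : nat) (a b : R) :
  (0 < n)%N ->
  permanent (a *: flat_mx R n + b *: 1%:M) =
    n`!%:R / n%:R ^+ n
      * \sum_(k < n.+1) a ^+ (n - k) * (n%:R * b) ^+ k / k`!%:R.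
Proof.
move=> n_gt0.
have fixers (S : {set 'I_n}) :
    \sum_(s : 'S_n) \prod_i (if i \in S then b * (i == s i)%:R else a / n%:R)
      = b ^+ #|S| * (a / n%:R) ^+ (n - #|S|) * (n - #|S|)`!%:R.
  have cS : #|~: S| = (n - #|S|)%N by rewrite cardsCs setCK card_ord.
  rewrite -{2}cS -card_perm -sumr_const.
  rewrite [LHS](bigID (perm_on (~: S))) /= [X in _ + X]big1 ?addr0 => [|s].
    rewrite mulr_sumr; apply: eq_bigr => s fixS.
    rewrite mulr1 (bigID (mem S)) /=; congr (_ * _).
      rewrite -prodr_const; apply: eq_bigr => i iS; rewrite iS.
      by rewrite (out_perm fixS) ?inE ?iS // eqxx mulr1.
    rewrite -cS -prodr_const; apply: eq_big => [i|i /negbTE -> //].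
    by rewrite inE.
  move=> /subsetPn [x]; rewrite !inE => sx /negPn xS.
  by rewrite (bigD1 x) //= xS eq_sym (negbTE sx) mulr0 mul0r.
transitivity (\sum_(S : {set 'I_n})
    b ^+ #|S| * (a / n%:R) ^+ (n - #|S|) * (n - #|S|)`!%:R).
  under [RHS]eq_bigr => S _ do rewrite -fixers.
  rewrite [RHS]exchange_big; apply: eq_bigr => s _ /=.
  by rewrite -bigA_distr; apply: eq_bigr => i _; rewrite !mxE mul1r addrC.
rewrite (partition_big (fun S : {set 'I_n} => inord #|S| : 'I_n.+1) xpredT) //=.
rewrite mulr_sumr; apply: eq_bigr => k _.
have kn : (k <= n)%N by rewrite -ltnS.
transitivity (\sum_(S : {set 'I_n} | #|S| == k)
    b ^+ k * (a / n%:R) ^+ (n - k) * (n - k)`!%:R).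
  apply: eq_big => [S|S /eqP <-].
    by rewrite -val_eqE /= inordK // ltnS -[X in (_ <= X)%N]card_ord max_card.
  by rewrite inordK // ltnS -[X in (_ <= X)%N]card_ord max_card.
have n0 : n%:R != 0 :> R by rewrite pnatr_eq0 -lt0n.
rewrite sumr_const -cardsE card_draws card_ord -[LHS]mulr_natr.
rewrite -(bin_fact kn) !natrM expr_div_n (exprMn _ n%:R b).
rewrite -[X in _ / _ ^+ X](subnK kn) exprD.
have fact_neq0 m : m`!%:R != 0 :> R by rewrite pnatr_eq0 -lt0n fact_gt0.
by field; rewrite ?expf_neq0 ?fact_neq0.
Qed.

(** * Stability and capacity *)

Section Permanent.
Variables (K : comPzRingType) (n : nat).
Implicit Types (M : 'M[K]_n).

Lemma permanent_map (L : comPzRingType) (f : {rmorphism K -> L}) M :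
  permanent (map_mx f M) = f (permanent M).
Proof.
rewrite /permanent rmorph_sum; apply: eq_bigr => s _.
by rewrite rmorph_prod; apply: eq_bigr => i _; rewrite mxE.
Qed.

Lemma permanent_scale_col (d : 'I_n -> K) M :
  permanent (\matrix_(i, j) (d j * M i j)) = (\prod_j d j) * permanent M.
Proof.
rewrite /permanent mulr_sumr; apply: eq_bigr => s _.
rewrite [X in _ = X * _](reindex_inj (@perm_inj _ s)) -big_split /=.
by apply: eq_bigr => i _; rewrite mxE.
Qed.

Lemma permanent_col_perm (u : 'S_n) M : permanent (col_perm u M) = permanent M.
Proof.
rewrite /permanent [RHS](reindex_inj (mulIg u)); apply: eq_bigr => s _.
by apply: eq_bigr => i _; rewrite mxE permM.
Qed.

Lemma permanent_col0 (j : 'I_n) M : (forall i, M i j = 0) -> permanent M = 0.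
Proof.
move=> M0; apply: big1 => s _; rewrite (bigD1 (s^-1%g j)) //=.
by rewrite permKV M0 mul0r.
Qed.

(** With [Z] equal to M x, the permanent is m! times the derivative of prod_i (M x)_i, taken once in
    each variable of index at least [m]. *)
Definition fill_columns M (m : nat) (Z : 'I_n -> K) : 'M[K]_n :=
  \matrix_(i, j) if (j < m)%N then Z i else M i j.

Lemma permanent_fill_scale M m (w : K) Z :
  permanent (fill_columns M m (fun i => w * Z i))
    = (\prod_(j < n) if (j < m)%N then w else 1)
      * permanent (fill_columns M m Z).
Proof.
rewrite -permanent_scale_col; congr permanent; apply/matrixP => i j.
by rewrite !mxE; case: ifP; rewrite ?mul1r.
Qed.

Lemma permanent_fill_all M Z :
  permanent (fill_columns M n Z) = n`!%:R * \prod_i Z i.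
Proof.
rewrite /permanent mulr_natl -[in RHS]card_Sn -sumr_const.
apply: eq_big => [s|s _]; first by rewrite inE.
by apply: eq_bigr => i _; rewrite mxE ltn_ord.
Qed.

Lemma eq_fill M m Z Z' : Z =1 Z' -> fill_columns M m Z = fill_columns M m Z'.
Proof. by move=> ZZ'; apply/matrixP => i j; rewrite !mxE ZZ'. Qed.

End Permanent.

Lemma map_fill (K L : comPzRingType) n (f : {rmorphism K -> L}) (M : 'M[K]_n) m
    (Z : 'I_n -> K) :
  map_mx f (fill_columns M m Z) = fill_columns (map_mx f M) m (f \o Z).
Proof. by apply/matrixP => i j; rewrite !mxE; case: ifP. Qed.

Lemma deriv_prod (K : comNzRingType) (I : finType) (F : I -> {poly K}) :
  (\prod_i F i)^`() = \sum_i (F i)^`() * \prod_(k | k != i) F k.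
Proof.
suff gen (r : seq I) : uniq r ->
    (\prod_(i <- r) F i)^`()
      = \sum_(i <- r) (F i)^`() * \prod_(k <- r | k != i) F k.
  rewrite -big_enum gen ?enum_uniq // big_enum; apply: eq_bigr => i _ /=.
  by rewrite big_enum_cond.
elim: r => [|a r IHr] /=; first by rewrite !big_nil derivC.
case/andP => ar ur; rewrite !big_cons derivM IHr // eqxx mulr_sumr.
congr (_ * _ + _).
  rewrite big_seq [RHS]big_seq_cond; apply: eq_bigl => i.
  case: (boolP (i \in r)) => //= ir.
  by rewrite (memPn ar).
rewrite !(big_seq_cond xpredT); apply: eq_bigr => i; rewrite andbT => ir.
by rewrite big_cons (memPnC ar) // mulrCA.
Qed.

Lemma deriv_permanent (K : comNzRingType) n (M : 'M[{poly K}]_n) :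
  (permanent M)^`()
    = \sum_j permanent (\matrix_(i, k) if k == j then (M i k)^`() else M i k).
Proof.
rewrite /permanent raddf_sum [RHS]exchange_big; apply: eq_bigr => s _ /=.
rewrite deriv_prod [RHS](reindex_inj (@perm_inj _ s)); apply: eq_bigr => i _.
rewrite [RHS](bigD1 i) //= mxE eqxx; congr (_ * _).
by apply: eq_bigr => k ki; rewrite mxE (inj_eq perm_inj) (negbTE ki).
Qed.

(** * Restriction of these permanents to a line *)

Section Pencil.
Variables (K : idomainType) (n : nat) (M : 'M[K]_n).

Definition fill_pencil (m : nat) (Z c : 'I_n -> K) : {poly K} :=
  permanent (fill_columns (map_mx polyC M) m
    (fun i => (c i)%:P * 'X + (Z i)%:P)).

Lemma horner_fill_pencil m Z c t :
  (fill_pencil m Z c).[t]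
    = permanent (fill_columns M m (fun i => Z i + t * c i)).
Proof.
rewrite -horner_evalE -permanent_map map_fill; congr permanent.
apply/matrixP => i j; rewrite !mxE /= /horner_eval.
by case: ifP => _; rewrite !hornerE // addrC mulrC.
Qed.

(** Differentiating any of the [m.+1] filled columns puts column [m] of [M] in its place; a column
    swap makes these terms equal, and the unfilled columns are constant. *)
Lemma deriv_fill_pencil m (mn : (m < n)%N) Z :
  (fill_pencil m.+1 Z (fun i => M i (Ordinal mn)))^`().[0]
    = m.+1%:R * permanent (fill_columns M m Z).
Proof.
set o := Ordinal mn; rewrite deriv_permanent horner_sum.
transitivity (\sum_(j < n) if (j < m.+1)%N
    then permanent (fill_columns M m Z) else 0); last first.
  rewrite -big_mkcond sumr_const -[LHS]mulr_natl; congr (_%:R * _).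
  rewrite -sum1_card -(big_ord_widen _ (fun=> 1%N)) //.
  by rewrite sum_nat_const card_ord muln1.
apply: eq_bigr => j _; rewrite -horner_evalE -permanent_map.
case: ifP => jm; last first.
  apply: (@permanent_col0 _ _ j) => i.
  by rewrite !mxE eqxx jm derivC /= /horner_eval horner0.
rewrite -[RHS](permanent_col_perm (tperm o j)); congr permanent.
apply/matrixP => i k; rewrite !mxE /= /horner_eval.
case: tpermP => [->|->|/eqP ko /eqP kj].
- rewrite /= ltnSn; case: eqP => [<-|/eqP oj].
    by rewrite /= ltnn derivD derivM derivX !derivC !hornerE.
  rewrite ltn_neqAle -ltnS jm andbT.
  by rewrite -(inj_eq val_inj) eq_sym /= in oj; rewrite oj !hornerE.
- by rewrite eqxx jm /= ltnn derivD derivM derivX !derivC !hornerE.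
rewrite (negbTE kj) ltnS leq_eqVlt.
have -> : (k == m :> nat) = false by apply: negbTE.
by rewrite /=; case: ifP => _; rewrite !hornerE.
Qed.

Hypothesis M_neq0 : forall i j, M i j != 0.

(** Every product in the permanent has degree exactly [m], and the leading coefficients add up to
    the permanent filled with [c]. *)
Lemma size_fill_pencil m (Z c : 'I_n -> K) : (m <= n)%N ->
  (forall i, c i != 0) -> permanent (fill_columns M m c) != 0 ->
  size (fill_pencil m Z c) = m.+1.
Proof.
move=> mn c0 perm0.
pose G (i j : 'I_n) : {poly K} := if (j < m)%N then (c i)%:P * 'X + (Z i)%:P
  else (M i j)%:P.
have sG i j : size (G i j) = (1 + (j < m))%N.
  rewrite /G; case: ifP => _; last by rewrite size_polyC M_neq0.
  by rewrite size_MXaddC polyC_eq0 (negbTE (c0 i)) size_polyC c0.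
have G0 i j : G i j != 0 by rewrite -size_poly_eq0 sG.
have lG i j : lead_coef (G i j) = if (j < m)%N then c i else M i j.
  rewrite lead_coefE sG /G; case: ifP => _ /=; last by rewrite coefC.
  by rewrite coefD coefMX !coefC /= addr0.
have sm : (\sum_(j < n) (j < m) = m)%N.
  rewrite -big_mkcond /= -(big_ord_widen _ (fun=> 1%N)) //.
  by rewrite sum_nat_const card_ord muln1.
have sms (s : 'S_n) : (\sum_(i < n) (s i < m) = m)%N.
  by rewrite -[RHS]sm [RHS](reindex_inj (@perm_inj _ s)).
have sP (s : 'S_n) : size (\prod_i G i (s i)) = m.+1.
  rewrite size_prod // (eq_bigr _ (fun i _ => sG _ _)) big_split /= sms.
  by rewrite sum_nat_const !card_ord muln1; lia.
have E : fill_pencil m Z c = \sum_(s : 'S_n) \prod_i G i (s i).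
  apply: eq_bigr => s _; apply: eq_bigr => i _; rewrite !mxE /G.
  by case: ifP.
have cm : (fill_pencil m Z c)`_m = permanent (fill_columns M m c).
  rewrite E coef_sum; apply: eq_bigr => s _.
  have -> : (\prod_i G i (s i))`_m = lead_coef (\prod_i G i (s i)).
    by rewrite lead_coefE sP.
  by rewrite lead_coef_prod; apply: eq_bigr => i _; rewrite lG mxE.
apply/eqP; rewrite eqn_leq; apply/andP; split.
  rewrite E; apply: leq_trans (size_sum _ _ _) _.
  by apply/bigmax_leqP => s _; rewrite sP.
rewrite ltnNge; apply/negP => /leq_sizeP/(_ m (leqnn m)).
by rewrite cm => /eqP; rewrite (negbTE perm0).
Qed.

End Pencil.

(** Logarithmic derivative at 0. *)
Lemma deriv_split_at0 (F : fieldType) (a : F) (r : seq F) : 0 \notin r ->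
  let p := a *: \prod_(z <- r) ('X - z%:P) in
  p^`().[0] = p.[0] * \sum_(z <- r) - z^-1.
Proof.
move=> r0 /=; rewrite derivZ !hornerZ -mulrA; congr (_ * _).
elim: r r0 => [|z r IHr]; first by rewrite !big_nil derivC hornerC mulr0.
rewrite inE negb_or eq_sym => /andP [z0 /IHr {}IHr].
rewrite !big_cons derivM derivXsubC hornerD !hornerM IHr hornerXsubC hornerC.
by field.
Qed.

(** * Stability and real-rootedness of pencils *)

Section Stability.
Variables (R : rcfType) (n : nat) (A : 'M[R]_n).
Hypothesis A_gt0 : forall i j, 0 < A i j.
Local Notation C := R[i].
Local Notation Re := (@complex.Re R).
Let AC := map_mx (real_complex R) A.

Let AC_neq0 i j : AC i j != 0.
Proof. by rewrite mxE fmorph_eq0 gt_eqF. Qed.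

Let Re_real_mul (x : R) (z : C) : Re (z * real_complex R x) = Re z * x.
Proof. by case: z => u v /=; rewrite mulr0 subr0. Qed.

Let ReD (y z : C) : Re (y + z) = Re y + Re z.
Proof. by case: y z => ? ? []. Qed.

Lemma permanent_gt0 (M : 'M[R]_n) : (forall i j, 0 < M i j) -> 0 < permanent M.
Proof.
move=> M0; rewrite /permanent (bigD1 1%g) //=.
apply: ltr_pwDl; first by apply: prodr_gt0.
by apply: sumr_ge0 => s _; apply: prodr_ge0 => i _; apply: ltW.
Qed.

Lemma fill_gt0 m (Z : 'I_n -> R) : (forall i, 0 < Z i) ->
  0 < permanent (fill_columns A m Z).
Proof. by move=> Z0; apply: permanent_gt0 => i j; rewrite mxE; case: ifP. Qed.

Lemma fill_real m (Z : 'I_n -> R) :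
  permanent (fill_columns AC m (real_complex R \o Z))
    = real_complex R (permanent (fill_columns A m Z)).
Proof. by rewrite -permanent_map map_fill. Qed.

Let size_pencilC m Z (c : 'I_n -> R) (c' : 'I_n -> C) : (m <= n)%N ->
  (forall i, c' i = real_complex R (c i)) -> (forall i, 0 < c i) ->
  size (fill_pencil AC m Z c') = m.+1.
Proof.
move=> mn cc' c0; apply: size_fill_pencil => //= [i|].
  by rewrite cc' fmorph_eq0 gt_eqF.
by rewrite (eq_fill _ _ cc') fill_real fmorph_eq0 gt_eqF // fill_gt0.
Qed.

Lemma size_pencil m Z (c : 'I_n -> R) : (m <= n)%N -> (forall i, 0 < c i) ->
  size (fill_pencil A m Z c) = m.+1.
Proof.
move=> mn c0; apply: size_fill_pencil => //= [i j|i|].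
- by rewrite gt_eqF.
- by rewrite gt_eqF.
- by rewrite gt_eqF // fill_gt0.
Qed.

(* If all roots z of p lie in the open left half-plane, then
   p'(0) / p(0) = sum_z -1/z has positive real part. *)
Lemma fill_stable m (Z : 'I_n -> C) : (m <= n)%N ->
  (forall i, 0 < Re (Z i)) -> permanent (fill_columns AC m Z) != 0.
Proof.
(* Downward induction from [m = n], where the permanent is n! times the product of the [Z i]. *)
move=> mn; rewrite -(subKn mn); move: (n - m)%N (leq_subr m n) => k kn {m mn}.
elim: k kn Z => [_|k IHk kn] Z Z0.
  rewrite subn0 permanent_fill_all mulf_neq0 ?pnatr_eq0 -?lt0n ?fact_gt0 //.
  by apply/prodf_neq0 => i _; apply/eqP => Zi; move: (Z0 i); rewrite Zi ltxx.
set m := (n - k.+1)%N; have mn : (m < n)%N by rewrite /m; lia.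
have {}IHk W : (forall i, 0 < Re (W i)) ->
    permanent (fill_columns AC m.+1 W) != 0.
  by have -> : m.+1 = (n - k)%N; [rewrite /m; lia | exact/IHk/ltnW].
pose c i := A i (Ordinal mn).
have cE i : AC i (Ordinal mn) = real_complex R (c i) by rewrite mxE.
pose p := fill_pencil AC m.+1 Z (fun i => AC i (Ordinal mn)).
have sp : size p = m.+2.
  exact: (size_pencilC Z mn cE (fun i => A_gt0 i (Ordinal mn))).
have [r pr] := closed_field_poly_normal p.
have p0 : p != 0 by rewrite -size_poly_eq0 sp.
(* A root with nonnegative real part would keep the filling in the right half-plane, where the
   induction hypothesis forbids a zero. *)
have root_r z : z \in r -> Re z < 0.
  move=> zr; have : root p z.
    by rewrite pr rootZ ?lead_coef_eq0 // root_prod_XsubC.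
  rewrite rootE /p horner_fill_pencil; apply: contraTT; rewrite -leNgt => z0.
  apply: IHk => i; rewrite ReD cE Re_real_mul.
  by move: z0 (Z0 i) (A_gt0 i (Ordinal mn)); rewrite -/(c i); nra.
have r0 : 0 \notin r by apply/negP => /root_r; rewrite ltxx.
have := deriv_fill_pencil AC mn Z; rewrite -/p pr => /= E.
apply/negP => /eqP W0; move: E; rewrite W0 mulr0.
rewrite (deriv_split_at0 _ r0) -pr => /eqP; rewrite mulf_eq0 => /orP [].
  rewrite /p horner_fill_pencil; apply/negP/IHk => i.
  by rewrite mul0r addr0.
have inv_pos z : z \in r -> 0 < Re (- z^-1).
  move=> /root_r; case: z => u v /= u0.
  by rewrite -mulNr divr_gt0 ?oppr_gt0 //; nra.
move=> /eqP /(congr1 Re); rewrite (big_morph Re ReD (erefl _)).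
case: r pr inv_pos {root_r r0} => [|z r] pr inv_pos.
  move: sp; rewrite pr big_nil => sp; have := size_scale_leq (lead_coef p) 1.
  by rewrite sp size_poly1.
rewrite big_cons => /eqP; rewrite gt_eqF // ltr_pwDl ?inv_pos ?mem_head //.
rewrite big_seq; apply: sumr_ge0 => y yr.
by apply/ltW/inv_pos; rewrite inE yr orbT.
Qed.

(** For any other [z], multiplication by 1, i or -i moves all entries of b + z c into the open right
    half-plane; by homogeneity [fill_stable] excludes such a root. *)
Lemma fill_pencil_root m (b c : 'I_n -> R) (z : C) : (m <= n)%N ->
  (forall i, 0 < b i) -> (forall i, 0 < c i) ->
  root (map_poly (real_complex R) (fill_pencil A m b c)) z ->
  exists2 x : R, x < 0 & z = real_complex R x.
Proof.
move=> mn b0 c0; rewrite rootE.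
have -> : map_poly (real_complex R) (fill_pencil A m b c)
    = fill_pencil AC m (real_complex R \o b) (real_complex R \o c).
  rewrite /fill_pencil -permanent_map; congr permanent.
  apply/matrixP => i j; rewrite !mxE; case: ifP => _ /=.
    by rewrite rmorphD rmorphM /= map_polyX !map_polyC.
  by rewrite map_polyC.
rewrite horner_fill_pencil; case: z => x y /eqP rt.
have rot (w : C) : (forall i, 0 < Re (w * (real_complex R (b i)
    + Complex x y * real_complex R (c i)))) -> False.
  move=> w0; have := fill_stable mn w0; rewrite permanent_fill_scale.
  by rewrite rt mulr0 eqxx.
have [y0|y0|y0] := ltrgtP y 0.
- by case: (rot (Complex 0 1)) => i /=; move: (c0 i); nra.
- by case: (rot (Complex 0 (-1))) => i /=; move: (c0 i); nra.
exists x; last by rewrite y0.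
rewrite ltNge; apply/negP => x0; case: (rot 1) => i /=.
move: (b0 i) (c0 i); rewrite y0; nra.
Qed.

(** All roots z are real and negative, so p(t)/p(0) is the product of the [m] nonnegative factors 1
    - t/z; their mean is read off from the logarithmic derivative. *)
Lemma fill_pencil_amgm m (b c : 'I_n -> R) (t : R) : (0 < m <= n)%N ->
  (forall i, 0 < b i) -> (forall i, 0 < c i) -> 0 <= t ->
  let p := fill_pencil A m b c in
  p.[t] <= p.[0] * (1 + t * (p^`().[0] / p.[0]) / m%:R) ^+ m.
Proof.
move=> /andP [m0 mn] b0 c0 t0 /=; set p := fill_pencil _ _ _ _.
have sp : size p = m.+1 by apply: size_pencil.
have p00 : 0 < p.[0].
  by rewrite horner_fill_pencil; apply: fill_gt0 => i; rewrite mul0r addr0.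
have pn0 : p != 0 by rewrite -size_poly_eq0 sp.
have [r pr] := closed_field_poly_normal (map_poly (real_complex R) p).
have real_root z : z \in r -> exists2 x : R, x < 0 & z = real_complex R x.
  move=> zr; apply: (fill_pencil_root mn b0 c0).
  by rewrite -/p pr rootZ ?lead_coef_eq0 ?map_poly_eq0 // root_prod_XsubC.
pose s := map (@complex.Re R) r.
have rs : r = map (real_complex R) s.
  rewrite -map_comp -[LHS]map_id; by apply/eq_in_map => z /real_root [x _ ->].
have s_lt0 x : x \in s -> x < 0.
  by case/mapP => z /real_root [y y0 ->] ->.
have ps : p = lead_coef p *: \prod_(z <- s) ('X - z%:P).
  apply: (@map_poly_inj _ _ (real_complex R)); rewrite {1}pr lead_coef_map.
  rewrite map_polyZ rmorph_prod rs big_map; congr (_ *: _).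
  by apply: eq_bigr => z _; rewrite rmorphB /= map_polyX map_polyC.
have ss : size s = m.
  have := sp; rewrite {1}ps size_scale ?lead_coef_eq0 // size_prod_XsubC.
  by case.
have s0 : 0 \notin s by apply/negP => /s_lt0; rewrite ltxx.
have -> : p^`().[0] / p.[0] = \sum_(z <- s) - z^-1.
  rewrite {1}ps (deriv_split_at0 _ s0) -ps mulrAC divff ?mul1r //.
  by rewrite gt_eqF.
have -> : p.[t] = p.[0] * \prod_(z <- s) (1 + t * - z^-1).
  rewrite ps !hornerZ -mulrA !horner_prod -big_split /=; congr (_ * _).
  rewrite big_seq [RHS]big_seq; apply: eq_bigr => z /s_lt0 z0.
  by rewrite !hornerE; field; rewrite lt_eqF.
rewrite (ler_pM2l p00).
rewrite -ss [\sum_(z <- s) _](big_nth 0).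
rewrite [\prod_(z <- s) _](big_nth 0) !big_mkord.
pose E (i : 'I_(size s)) := 1 + t * - (s`_i)^-1.
have E_ge0 : {in [pred _ : 'I_(size s) | true], forall i, 0 <= E i}.
  move=> i _; rewrite addr_ge0 // mulr_ge0 // -invrN invr_ge0 oppr_ge0 ltW //.
  by rewrite s_lt0 // mem_nth.
have [+ _] := leif_AGM E_ge0.
have -> : #|[pred _ : 'I_(size s) | true]| = size s by rewrite card_ord.
rewrite /E big_split /= sumr_const card_ord -mulr_sumr mulrDl.
by rewrite divff // pnatr_eq0 ss -lt0n.
Qed.

End Stability.

(** The derivative of the fully filled pencil, a multiple of a product of linear factors, is
    computed in two ways. *)
Lemma permanent_fill_but_last (K : idomainType) n (M : 'M[K]_n.+1) Z :
  n.+1%:R != 0 :> K ->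
  permanent (fill_columns M n Z)
    = n`!%:R * \sum_i M i ord_max * \prod_(k | k != i) Z k.
Proof.
move=> n0; apply: (mulfI n0); rewrite mulrA -natrM -factS.
have -> : ord_max = Ordinal (leqnn n.+1) :> 'I_n.+1 by apply: val_inj.
rewrite -deriv_fill_pencil /fill_pencil permanent_fill_all -polyC_natr.
rewrite deriv_mulC deriv_prod hornerCM horner_sum; congr (_ * _).
apply: eq_bigr => i _.
rewrite derivD derivM derivX !derivC mul0r add0r mulr1 addr0 hornerM hornerC.
rewrite horner_prod; congr (_ * _); apply: eq_bigr => k _.
by rewrite hornerD hornerMX !hornerC mulr0 add0r.
Qed.

(** * From capacity to the permanent *)

Section Capacity.
Variables (R : rcfType) (n : nat) (A : 'M[R]_n).
Hypothesis A_gt0 : forall i j, 0 < A i j.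

(* Gurvits' induction: by the AM-GM bound at the optimal t, eliminating one
   variable costs the capacity a factor m^m / (m+1)^(m+1). *)
Lemma permanent_ge_capacity m (K : R) : (0 < m <= n)%N ->
  (forall x : 'I_n -> R, (forall j, 0 < x j) ->
    K * \prod_(j < n | (j < m)%N) x j <=
      permanent (fill_columns A m
        (fun i => \sum_(j < n | (j < m)%N) A i j * x j))) ->
  K / m%:R ^+ m <= permanent A.
Proof.
case: m => // m /=; elim: m K => [|m IHm] K mn capK.
  (* At [x = 1] the single filled column is the first column of [A] itself. *)
  have := capK (fun=> 1) (fun=> ltr01); rewrite big1 // !mulr1 divr1.
  rewrite (_ : fill_columns _ _ _ = A) //; apply/matrixP => i j; rewrite mxE.
  case: ifP => // j1; rewrite (big_pred1 j) ?mulr1 // => k /=.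
  by rewrite -val_eqE /=; move: j1; lia.
have m1n : (m.+1 < n)%N by [].
set o := Ordinal m1n.
have -> : K / m.+2%:R ^+ m.+2
    = (K * m.+1%:R ^+ m.+1 / m.+2%:R ^+ m.+2) / m.+1%:R ^+ m.+1.
  by field; rewrite !expf_neq0 // gt_eqF // ltr0n.
apply: IHm => [|x x0]; first exact: ltnW.
set X := \prod_(j < n | _) x j.
pose b i := \sum_(j < n | (j < m.+1)%N) A i j * x j.
pose c (i : 'I_n) : R := A i o.
have b0 i : 0 < b i.
  rewrite /b (bigD1 (Ordinal (leq_ltn_trans (leq0n _) m1n))) //=.
  by rewrite ltr_pwDl ?mulr_gt0 // sumr_ge0 // => j _; rewrite ltW ?mulr_gt0.
set W := permanent (fill_columns A m.+1 b).
have W0 : 0 < W by apply: fill_gt0.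
pose p := fill_pencil A m.+2 b c.
have p00 : 0 < p.[0].
  by rewrite horner_fill_pencil; apply: fill_gt0 => // i; rewrite mul0r addr0.
have p'0 : p^`().[0] = m.+2%:R * W by rewrite -deriv_fill_pencil.
have m10 : 0 < m.+1%:R :> R by rewrite ltr0n.
have m20 : 0 < m.+2%:R :> R by rewrite ltr0n.
have mE : m.+2%:R = m.+1%:R + 1 :> R by rewrite -natr1.
(* The minimiser of (1 + t W/p(0))^(m+2) / t. *)
pose t := p.[0] / (m.+1%:R * W).
have t0 : 0 < t by rewrite divr_gt0 // mulr_gt0.
have upper : p.[t] <= p.[0] * (m.+2%:R / m.+1%:R) ^+ m.+2.
  have c0 i : 0 < c i by apply: A_gt0.
  have := fill_pencil_amgm (m := m.+2) A_gt0 mn b0 c0 (ltW t0).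
  rewrite /= -/p p'0; congr (_ <= _ * _ ^+ _).
  by rewrite /t mE; field; rewrite nat1r natr1 !pnatr_eq0 !gt_eqF.
(* The capacity hypothesis at [x] with the value [t] in coordinate [o]. *)
have lower : K * (X * t) <= p.[t].
  pose y j := if j == o then t else x j.
  have y0 j : 0 < y j by rewrite /y; case: ifP.
  have lt_o (j : 'I_n) : (j < m.+2)%N && (j != o) = (j < m.+1)%N.
    by rewrite -val_eqE /=; lia.
  have ne_o (j : 'I_n) : (j < m.+1)%N -> (j == o) = false.
    by move=> jm; apply/eqP => jo; move: jm; rewrite jo ltnn.
  have := capK y y0; rewrite (bigD1 o) //= {1}/y eqxx (eq_bigl _ _ lt_o).
  rewrite (eq_bigr x) => [|j jm]; last by rewrite /y ne_o.
  rewrite -/X [t * X]mulrC horner_fill_pencil; congr (_ <= permanent _).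
  apply: eq_fill => i; rewrite (bigD1 o) //= {1}/y eqxx (eq_bigl _ _ lt_o).
  rewrite addrC [A i o * t]mulrC; congr (_ + _).
  by apply: eq_bigr => j jm; rewrite /y ne_o.
have D0 : 0 < m.+1%:R * W by rewrite mulr_gt0.
have := le_trans lower upper.
rewrite /t (mulrA X) (mulrA K) (ler_pdivrMr _ _ D0).
rewrite expr_div_n [m.+1%:R ^+ m.+2]exprS => le.
rewrite -/X -/b -/W; move: le.
have e1 : 0 < m.+1%:R ^+ m.+1 :> R by rewrite exprn_gt0.
have e2 : 0 < m.+2%:R ^+ m.+2 :> R by rewrite exprn_gt0.
move: (m.+1%:R ^+ m.+1) (m.+2%:R ^+ m.+2) e1 e2 => u v u0 v0.
have -> : p.[0] * (v / (m.+1%:R * u)) * (m.+1%:R * W) = p.[0] * (v / u * W).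
  by field; rewrite nat1r pnatr_eq0 !gt_eqF.
rewrite (mulrA K X) [K * X * _]mulrC (ler_pM2l p00) => le.
have -> : K * u / v * X = u / v * (K * X) by field; rewrite gt_eqF.
have -> : W = u / v * (v / u * W) by field; rewrite !gt_eqF.
by rewrite ler_pM2l // divr_gt0.
Qed.

End Capacity.

(** * The lower bound *)

From mathcomp Require Import classical_sets set_interval topology normedtype.
From mathcomp Require Import sequences derive realfun exp.
Import numFieldNormedType.Exports.

(** * Inequalities for the logarithm and the exponential *)

Section Logarithm.
Variable R : realType.
Implicit Types a b c x : R.

Lemma mean_value (f df : R -> R) a b : a <= b ->
  (forall x, a <= x <= b -> is_derive x 1 f (df x)) ->
  exists2 c, a <= c <= b & f b - f a = df c * (b - a).
Proof.
move=> ab fdf; have [||c + ->] := @MVT_segment R f df a b ab.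
- by move=> x; rewrite in_itv /= => /andP [ax xb]; apply: fdf; rewrite !ltW.
- apply: derivable_within_continuous => x; rewrite in_itv /= => /fdf dfx.
  exact: ex_derive.
by rewrite in_itv; exists c.
Qed.

(** A Taylor remainder, nondecreasing below 1 because its derivative is x^2/(1-x). *)
Let remainder x : R := - ln (1 - x) - x - x ^+ 2 / 2.

Let is_derive_ln1B x :
  x < 1 -> is_derive x 1 (fun y => ln (1 - y)) (- (1 - x)^-1).
Proof.
move=> x1; have d1 : is_derive (1 - x) 1 (@ln R) (1 - x)^-1.
  by apply: is_derive1_ln; rewrite subr_gt0.
have d2 : is_derive x 1 (fun y : R => 1 - y) (-1).
  by apply: is_derive_eq; rewrite add0r mul1r.
have := is_derive1_comp (f := @ln R) (g := fun y : R => 1 - y) (x := x).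
by move=> /(_ _ _ d1 d2)/is_derive_eq; apply; rewrite mulrN1.
Qed.

Let remainder_le a b : a <= b -> b < 1 -> remainder a <= remainder b.
Proof.
move=> ab b1; have [|c /andP [ac cb] E] :=
  @mean_value remainder (fun x => x ^+ 2 / (1 - x)) a b ab.
  move=> x /andP [_ xb]; have x1 := le_lt_trans xb b1.
  have d := is_derive_ln1B x1.
  rewrite /remainder; apply: is_derive_eq; rewrite /GRing.scale /=.
  by field; rewrite subr_eq0 gt_eqF.
rewrite -subr_ge0 E mulr_ge0 ?subr_ge0 // divr_ge0 ?sqr_ge0 // subr_ge0.
exact/ltW/(le_lt_trans cb b1).
Qed.

Lemma ln1D_ge x : 0 <= x -> x - x ^+ 2 / 2 <= ln (1 + x).
Proof.
move=> x0; have := @remainder_le (- x) 0.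
rewrite /remainder !subr0 ln1 oppr_le0 x0 ltr01 expr0n mul0r opprK sqrrN.
by move=> /(_ isT isT); lra.
Qed.

(* phi c = (1 - c) ln (1 - c) has phi'' c = 1 / (1 - c) >= 1 + c. *)
Lemma entropy_tangent_ge a c : 0 < a < 1 -> 0 <= c < 1 ->
  (1 - a) * ln (1 - a) - (1 + ln (1 - a)) * (c - a)
    + (1 + 2 * a / 3) / 2 * (c - a) ^+ 2 <= (1 - c) * ln (1 - c).
Proof.
move=> /andP [a0 a1] /andP [c0 c1].
(* Up to a constant, phi minus its tangent at [a] minus the double integral of 1 + x from [a]; the
   derivative is [remainder x - remainder a], so the minimum is at [a]. *)
pose h x := (1 - x) * ln (1 - x) + (1 + ln (1 - a)) * (x - a)
  - (x - a) ^+ 2 / 2 - (x - a) ^+ 2 * (x + 2 * a) / 6.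
have dh x : x < 1 -> is_derive x 1 h (remainder x - remainder a).
  move=> x1; have d := is_derive_ln1B x1.
  rewrite /h /remainder; apply: is_derive_eq; rewrite /GRing.scale /=.
  by field; rewrite subr_eq0 gt_eqF.
suff : h a <= h c.
  rewrite /h subrr expr0n /= !mul0r mulr0 !subr0 addr0 => hc.
  (* Dropping this term leaves the coefficient 1/2 + a/3. *)
  have : 0 <= (c - a) ^+ 2 * c by rewrite mulr_ge0 ?sqr_ge0.
  lra.
have [ac|/ltW ca] := leP a c.
  have [x /andP [_ xb]|x /andP [xa xb] E] := mean_value (f := h)
      (df := fun x => remainder x - remainder a) ac.
    by apply: dh; apply: le_lt_trans c1.
  rewrite -subr_ge0 E mulr_ge0 ?subr_ge0 // remainder_le //.
  exact: le_lt_trans c1.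
have [x /andP [_ xb]|x /andP [xa xb] E] := mean_value (f := h)
    (df := fun x => remainder x - remainder a) ca.
  by apply: dh; apply: le_lt_trans a1.
rewrite -subr_le0 E mulr_le0_ge0 ?subr_ge0 // subr_le0 remainder_le //.
Qed.

Lemma exp_partial_sum_le x n : 0 <= x ->
  \sum_(k < n) x ^+ k / k`!%:R <= expR x.
Proof.
move=> x0; have := @nondecreasing_cvgn_le R (series (exp_coeff x)).
move=> /(_ _ _ n); rewrite /series /= big_mkord; apply.
  by apply: nondecreasing_series => k _ _; apply: exp_coeff_ge0.
exact: is_cvg_series_exp_coeff.
Qed.

End Logarithm.

(** Jensen's inequality from the tangent of [ln] at the mean [m]; the linear corrections sum to
    zero. *)
Lemma ln_concave_sum (R : realType) (I : finType) (P : pred I) (p y : I -> R) :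
  (forall i, P i -> 0 <= p i) -> (forall i, P i -> 0 < y i) ->
  \sum_(i | P i) p i = 1 ->
  \sum_(i | P i) p i * ln (y i) <= ln (\sum_(i | P i) p i * y i).
Proof.
move=> p0 y0 p1; set m := \sum_(i | P i) p i * y i.
have m0 : 0 < m.
  rewrite lt_neqAle sumr_ge0 ?andbT => [|i Pi]; last first.
    by rewrite mulr_ge0 ?p0 // ltW ?y0.
  apply/eqP => /esym/eqP; rewrite psumr_eq0 => [/allP z|i Pi]; last first.
    by rewrite mulr_ge0 ?p0 // ltW ?y0.
  have /eqP := p1; rewrite big1 ?(eq_sym 0) ?oner_eq0 // => i Pi.
  have := z i (mem_index_enum i); rewrite Pi mulf_eq0 => /orP [/eqP //|].
  by rewrite gt_eqF ?y0.
have step i : P i -> p i * ln (y i) <= p i * ln m + (p i * y i / m - p i).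
  move=> Pi; have ym : 0 < y i / m by rewrite divr_gt0 ?y0.
  have : ln (y i / m) <= y i / m - 1.
    by rewrite -{1}[y i / m](subrK 1) addrC le_ln1Dx //; lra.
  rewrite ln_div ?posrE ?y0 // => le.
  have -> : p i * y i / m - p i = p i * (y i / m - 1) by ring.
  by rewrite -mulrDr ler_wpM2l ?p0 //; lra.
apply: le_trans (ler_sum _ step) _.
rewrite !big_split /= sumrN -!mulr_suml p1 -/m divff ?gt_eqF //.
by rewrite mul1r subrr addr0.
Qed.

(** * The gain from one column *)

Section LastColumn.
Variables (R : realType) (N : nat) (A : 'M[R]_N.+1).
Hypotheses (N_gt0 : (0 < N)%N) (A_gt0 : forall i j, 0 < A i j).
Hypothesis dsA : doubly_stochastic A.
Let c i := A i ord_max.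

Let compl_sum i : \sum_(j < N.+1 | (j < N)%N) A i j = 1 - c i.
Proof.
have [_ /(_ i) <- _] := dsA; rewrite [in RHS](bigD1 ord_max) //= addrC addrK.
apply: eq_bigl => j; rewrite -val_eqE /=; have := ltn_ord j; lia.
Qed.

Let c_lt1 i : c i < 1.
Proof.
rewrite -subr_gt0 -compl_sum (bigD1 ord0) //=.
by rewrite ltr_pwDl // sumr_ge0 // => j _; apply: ltW.
Qed.

Let E := \sum_i (1 - c i) * ln (1 - c i).

Let ln_prod_sum (P : pred 'I_N.+1) (y : 'I_N.+1 -> R) : (forall i, 0 < y i) ->
  ln (\prod_(i | P i) y i) = \sum_(i | P i) ln (y i).
Proof.
move=> y0; rewrite -[RHS]expRK; congr ln.
by rewrite expR_sum; apply: eq_bigr => i _; rewrite lnK ?posrE.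
Qed.

Let capacity (x : 'I_N.+1 -> R) : (forall j, 0 < x j) ->
  N`!%:R * expR E * \prod_(j < N.+1 | (j < N)%N) x j <=
    permanent (fill_columns A N
      (fun i => \sum_(j < N.+1 | (j < N)%N) A i j * x j)).
Proof.
move=> x0; pose b i := \sum_(j < N.+1 | (j < N)%N) A i j * x j.
rewrite -/b permanent_fill_but_last ?pnatr_eq0 // -mulrA.
rewrite ler_pM2l ?ltr0n ?fact_gt0 //.
have b0 i : 0 < b i.
  rewrite /b (bigD1 ord0) //= ltr_pwDl ?mulr_gt0 // sumr_ge0 // => j _.
  by rewrite ltW ?mulr_gt0.
have c1 i : 0 < 1 - c i by rewrite subr_gt0.
have prod0 (P : pred 'I_N.+1) (y : 'I_N.+1 -> R) :
    (forall i, 0 < y i) -> 0 < \prod_(i | P i) y i.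
  by move=> y0; apply: prodr_gt0.
(* First Jensen step: the weights [A i j / (1 - c i)] sum to 1 over the columns other than the
   last. *)
have rows i : (1 - c i) * ln (1 - c i)
    + \sum_(j < N.+1 | (j < N)%N) A i j * ln (x j) <= (1 - c i) * ln (b i).
  have : \sum_(j < N.+1 | (j < N)%N) A i j / (1 - c i) * ln (x j)
      <= ln (\sum_(j < N.+1 | (j < N)%N) A i j / (1 - c i) * x j).
    apply: ln_concave_sum => [j _|j _|]; rewrite ?divr_ge0 ?ltW //.
    by rewrite -mulr_suml compl_sum divff ?gt_eqF.
  under eq_bigr => j _ do rewrite mulrAC.
  under [X in _ <= ln X]eq_bigr => j _ do rewrite mulrAC.
  rewrite -!mulr_suml -/(b i) ln_div ?posrE // ler_pdivrMr // mulrC; lra.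
have total : E + \sum_(j < N.+1 | (j < N)%N) ln (x j)
    <= \sum_i (1 - c i) * ln (b i).
  apply: le_trans (ler_sum _ (fun i _ => rows i)).
  rewrite big_split /= lerD2l exchange_big /=.
  apply: ler_sum => j _; rewrite -mulr_suml.
  by have [_ _ ->] := dsA; rewrite mul1r.
pose T i := \prod_(k | k != i) b k.
have T0 i : 0 < T i by apply: prod0.
have mix := @ln_concave_sum R _ predT c T.
have {}mix : \sum_i c i * ln (T i) <= ln (\sum_i c i * T i).
  apply: mix => [i _|i _|]; [exact/ltW/A_gt0|exact: T0|].
  by have [_ _ ->] := dsA.
have Q0 : 0 < \sum_i c i * T i.
  have cT i : 0 < c i * T i by rewrite mulr_gt0 ?A_gt0.
  by rewrite (bigD1 ord0) //= ltr_pwDl // sumr_ge0 // => i _; apply: ltW.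
(* [T i] omits the factor [b i] and the [c i] sum to 1, so the second Jensen step produces exactly
   the weights [1 - c i]. *)
have mixE : \sum_i c i * ln (T i) = \sum_i (1 - c i) * ln (b i).
  have lnT i : ln (T i) = \sum_k ln (b k) - ln (b i).
    by rewrite /T ln_prod_sum // [in RHS](bigD1 i) //= addrC addrK.
  under eq_bigr => i _ do rewrite lnT mulrBr.
  rewrite big_split /= sumrN -mulr_suml.
  have [_ _ ->] := dsA; rewrite mul1r -sumrB; apply: eq_bigr => i _.
  by rewrite mulrBl mul1r.
rewrite -ler_ln ?posrE ?mulr_gt0 ?expR_gt0 ?prod0 //.
rewrite lnM ?posrE ?expR_gt0 ?prod0 // expRK ln_prod_sum //.
by rewrite (le_trans total) // -mixE.
Qed.

Lemma permanent_ge_last_column :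
  N.+1`!%:R / N.+1%:R ^+ N.+1 *
    (1 + (1 + 2 / (3 * N.+1%:R)) / 2 * \sum_i (A i ord_max - 1 / N.+1%:R) ^+ 2)
  <= permanent A.
Proof.
apply: le_trans (@permanent_ge_capacity _ _ A A_gt0 N _ _ capacity); last first.
  by rewrite N_gt0 leqnSn.
set s := \sum_i _ ^+ 2; set al := (_ / 2).
pose a : R := 1 / N.+1%:R.
have n0 : 0 < N.+1%:R :> R by rewrite ltr0n.
have N0 : 0 < N%:R :> R by rewrite ltr0n.
have nE : N.+1%:R = N%:R + 1 :> R by rewrite natr1.
have a01 : 0 < a < 1 by rewrite /a divr_gt0 //= ltr_pdivrMr // mul1r ltr1n.
have aE : 1 - a = N%:R / N.+1%:R.
  by rewrite /a nE; field; rewrite natr1 pnatr_eq0.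
have a1 : 0 < 1 - a by rewrite aE divr_gt0.
(* Summing the tangent inequality at [a]: the linear terms cancel, and the constants combine through
   N.+1 (1 - a) = N. *)
have EE : N%:R * ln (1 - a) + al * s <= E.
  have term i : (1 - a) * ln (1 - a) - (1 + ln (1 - a)) * (c i - a)
      + al * (c i - a) ^+ 2 <= (1 - c i) * ln (1 - c i).
    have -> : al = (1 + 2 * a / 3) / 2.
      by rewrite /al /a; field; rewrite nat1r pnatr_eq0.
    by apply: entropy_tangent_ge; rewrite // ltW //= ?c_lt1; apply: A_gt0.
  apply: le_trans (ler_sum _ (fun i _ => term i)).
  have sc : \sum_i (c i - a) = 0.
    rewrite big_split /= sumrN sumr_const card_ord; have [_ _ ->] := dsA.
    by rewrite -[a *+ _]mulr_natl /a mulrA mulr1 divff ?gt_eqF ?subrr.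
  rewrite !big_split /= sumrN -!mulr_sumr sc mulr0 subr0 -/s lerD2r.
  rewrite sumr_const card_ord -(mulr_natl (ln _)) mulrA.
  by rewrite [X in _ <= X * _](_ : _ = N%:R) // aE divfK // gt_eqF.
have N_fact : N.+1`!%:R = N.+1%:R * N`!%:R :> R by rewrite factS natrM.
have exE : (N%:R / N.+1%:R) ^+ N * (1 + al * s) <= expR E.
  apply: le_trans (_ : expR (N%:R * ln (1 - a) + al * s) <= _); last first.
    by rewrite ler_expR.
  rewrite expRD expRM_natl lnK ?posrE // aE ler_pM2l ?expR_ge1Dx //.
  by rewrite exprn_gt0 // divr_gt0.
have -> : N.+1`!%:R / N.+1%:R ^+ N.+1 * (1 + al * s)
    = N`!%:R / N%:R ^+ N * ((N%:R / N.+1%:R) ^+ N * (1 + al * s)).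
  rewrite N_fact expr_div_n exprS.
  have := exprn_gt0 N n0; have := exprn_gt0 N N0.
  move: (N%:R ^+ N) (N.+1%:R ^+ N) => u v u0 v0.
  by field; rewrite nat1r pnatr_eq0 !gt_eqF.
rewrite mulrAC ler_pM2r ?invr_gt0 ?exprn_gt0 //.
by rewrite ler_pM2l // ltr0n fact_gt0.
Qed.

End LastColumn.

(** Continuity at 0 from the right; it serves to pass from positive to nonnegative entries. *)
Lemma horner0_ge0 (R : realType) (p : {poly R}) :
  (forall x, 0 < x < 1 -> 0 <= p.[x]) -> 0 <= p.[0].
Proof.
move=> p_ge0.
have cp : (horner p x @[x --> 0^'+] --> p.[0])%classic.
  by apply: cvg_at_right_filter; apply: continuous_horner.
rewrite -(cvg_lim _ cp) //; apply: limr_ge; first exact: cvgP cp.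
near=> x; apply: p_ge0; apply/andP; split; near: x.
  exact: nbhs_right_gt.
exact: nbhs_right_lt.
Unshelve. all: by end_near.
Qed.

(** * Averaging over the columns, and matrices with zero entries *)

Section LowerBound.
Variables (R : realType) (N : nat).
Hypothesis N_gt0 : (0 < N)%N.
Local Notation n := N.+1.
Implicit Type A : 'M[R]_n.

Definition vdw_gain : R := (1 + 2 / (3 * n%:R)) / (2 * n%:R).

Let permanent_ge_positive A : (forall i j, 0 < A i j) -> doubly_stochastic A ->
  n`!%:R / n%:R ^+ n *
    (1 + vdw_gain * \sum_i \sum_j (A - flat_mx R n) i j ^+ 2) <= permanent A.
Proof.
move=> A0 [A_ge0 rowA colA].
have n0 : 0 < n%:R :> R by rewrite ltr0n.
have column j : n`!%:R / n%:R ^+ n * (1 + (1 + 2 / (3 * n%:R)) / 2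
    * \sum_i (A - flat_mx R n) i j ^+ 2) <= permanent A.
  rewrite -(permanent_col_perm (tperm j ord_max)).
  have := @permanent_ge_last_column R N (col_perm (tperm j ord_max) A) N_gt0.
  under [in X in X -> _]eq_bigr => i _ do rewrite !mxE tpermR.
  under [in X in _ -> X]eq_bigr => i _ do rewrite !mxE.
  apply=> [i k|]; first by rewrite mxE.
  split=> [i k|i|k]; first by rewrite mxE.
  - rewrite -(rowA i) [RHS](reindex_inj (@perm_inj _ (tperm j ord_max))).
    by apply: eq_bigr => k _; rewrite mxE.
  - by rewrite -(colA (tperm j ord_max k)); apply: eq_bigr => i _; rewrite mxE.
rewrite -(ler_pM2l n0) exchange_big /=.
have : \sum_(j < n) (n`!%:R / n%:R ^+ n * (1 + (1 + 2 / (3 * n%:R)) / 2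
    * \sum_i (A - flat_mx R n) i j ^+ 2)) <= \sum_(j < n) permanent A.
  by apply: ler_sum => j _; apply: column.
rewrite sumr_const card_ord -(mulr_natl (permanent A)).
rewrite -mulr_sumr big_split /= sumr_const card_ord -mulr_sumr.
congr (_ <= _); rewrite [RHS]mulrCA; congr (_ * _).
by rewrite /vdw_gain; field; rewrite nat1r pnatr_eq0.
Qed.

Lemma permanent_ge_doubly_stochastic A : doubly_stochastic A ->
  n`!%:R / n%:R ^+ n *
    (1 + vdw_gain * \sum_i \sum_j (A - flat_mx R n) i j ^+ 2) <= permanent A.
Proof.
move=> [A_ge0 rowA colA].
set C := n`!%:R / _; set S := \sum_i _.
have n0 : 0 < n%:R :> R by rewrite ltr0n.
(* The segment from [A] to the flat matrix: entries are positive for 0 < x < 1, and the squared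
   distance to the flat matrix scales by (1-x)^2. *)
pose B : 'M[{poly R}]_n := \matrix_(i, j)
  ((1 - 'X) * (A i j)%:P + 'X * (1 / n%:R)%:P).
pose p := permanent B - C%:P * (1 + (vdw_gain * S)%:P * (1 - 'X) ^+ 2).
have pE x : p.[x] = permanent ((1 - x) *: A + x *: flat_mx R n)
    - C * (1 + vdw_gain * S * (1 - x) ^+ 2).
  rewrite /p hornerD hornerN hornerCM hornerD hornerCM horner_exp.
  rewrite hornerD hornerN hornerX !hornerC; congr (_ - _).
  rewrite -horner_evalE -permanent_map; congr permanent.
  apply/matrixP => i j; rewrite !mxE /= /horner_eval.
  by rewrite hornerD !hornerM !hornerD hornerN hornerX !hornerC.
have : 0 <= p.[0]; last first.
  by rewrite pE subr0 expr1n mulr1 scale1r scale0r addr0 subr_ge0.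
apply: horner0_ge0 => x /andP [x0 x1]; rewrite pE subr_ge0.
have sumc : \sum_(j < n) x * (1 / n%:R) = x.
  rewrite sumr_const card_ord -(mulr_natl (x * _)).
  by field; rewrite nat1r pnatr_eq0.
have SE : \sum_i \sum_j ((1 - x) *: A + x *: flat_mx R n - flat_mx R n) i j ^+ 2
    = S * (1 - x) ^+ 2.
  rewrite /S big_distrl /=; apply: eq_bigr => i _; rewrite big_distrl /=.
  by apply: eq_bigr => j _; rewrite !mxE; ring.
have := @permanent_ge_positive ((1 - x) *: A + x *: flat_mx R n).
rewrite SE mulrA.
apply=> [i j|].
  rewrite !mxE ltr_wpDl ?mulr_gt0 ?invr_gt0 //.
  by rewrite mulr_ge0 // subr_ge0 ltW.
split=> [i j|i|j].
- by rewrite !mxE addr_ge0 ?mulr_ge0 ?invr_ge0 ?subr_ge0 // ltW.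
- under eq_bigr => j _ do rewrite !mxE.
  by rewrite big_split /= -mulr_sumr rowA sumc mulr1 subrK.
- under eq_bigr => i _ do rewrite !mxE.
  by rewrite big_split /= -mulr_sumr colA sumc mulr1 subrK.
Qed.

End LowerBound.

(** * Numerical bounds for the comparison permanent *)

Section FlatShift.
Variable R : realType.

Lemma permanent_flat n : permanent (flat_mx R n) = n`!%:R / n%:R ^+ n.
Proof.
rewrite /permanent -[in RHS]card_Sn mulr_natl -sumr_const.
apply: eq_big => [s|s _]; first by rewrite inE.
under eq_bigr => i _ do rewrite mxE mul1r.
by rewrite prodr_const card_ord exprVn.
Qed.

(* n^n / n! times the permanent of J + (I - J) / (n - 1). *)
Definition shift_ratio (n : nat) : R :=
  \sum_(k < n.+1) (1 - (n%:R - 1)^-1) ^+ (n - k)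
     * (n%:R / (n%:R - 1)) ^+ k / k`!%:R.

Lemma permanent_marcus_minc_le n (A : 'M[R]_n) : (1 < n)%N ->
  doubly_stochastic A ->
  permanent (marcus_minc A) <= n`!%:R / n%:R ^+ n *
    (1 + (\sum_i \sum_j (A - flat_mx R n) i j ^+ 2) / (n%:R - 1)
       * (shift_ratio n - 1)).
Proof.
move=> n1 dsA; have n_gt0 : (0 < n)%N by apply: ltnW.
have m0 : 0 < n%:R - 1 :> R by rewrite subr_gt0 ltr1n.
have -> : marcus_minc A
    = flat_mx R n + (- (n%:R - 1)^-1) *: (A - flat_mx R n).
  apply/matrixP => i j; rewrite !mxE.
  by field; rewrite pnatr_eq0 -lt0n n_gt0 gt_eqF.
apply: le_trans (permanent_flat_shift_le n1 dsA _) _.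
rewrite normrN ger0_norm ?invr_ge0 ?(ltW m0) // permanent_flat.
set y := (n%:R - 1)^-1; set S := \sum_i _.
have -> : flat_mx R n + y *: (1%:M - flat_mx R n)
    = (1 - y) *: flat_mx R n + y *: 1%:M.
  by rewrite scalerBr scalerBl scale1r addrCA addrC.
rewrite permanent_flat_identity // -/(shift_ratio n).
by rewrite le_eqVlt; apply/orP; left; apply/eqP; ring.
Qed.

(** The exact value is used at 4, where the formula of [shift_ratio_le] would give only 1 as a bound
    for the excess, too large for a positive difference. *)
Lemma shift_ratio4 : shift_ratio 4 = 112 / 81.
Proof.
rewrite /shift_ratio !big_ord_recl big_ord0 /= /bump /= !factS fact0 !natrM.
by field.
Qed.

(* With y = 1/(n-2) the sum is at most
   (1+y)^-n exp (n y) <= exp (n y^2 / 2) <= 1 / (1 - n y^2 / 2). *)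
Lemma shift_ratio_le n : (5 <= n)%N ->
  shift_ratio n - 1 <= n%:R / (2 * (n%:R - 2) ^+ 2 - n%:R).
Proof.
move=> n5; have [r rE] : exists r : R, r = n%:R by exists n%:R.
have r5 : 5 <= r by rewrite rE (ler_nat R 5).
have pos_neq0 (z : R) : 0 < z -> z != 0 by move=> z0; rewrite gt_eqF.
rewrite -rE.
pose y := (r - 2)^-1; have y0 : 0 < y by rewrite invr_gt0; lra.
have ratioE : 1 - (r - 1)^-1 = (1 + y)^-1.
  by rewrite /y; field; do ?[apply/andP; split]; apply: pos_neq0; lra.
have sumE : shift_ratio n
    = (1 + y)^-1 ^+ n * \sum_(k < n.+1) (r * y) ^+ k / k`!%:R.
  rewrite mulr_sumr; apply: eq_bigr => k _; rewrite -rE ratioE mulrA.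
  have -> : r / (r - 1) = r * y * (1 + y)^-1.
    by rewrite /y; field; do ?[apply/andP; split]; apply: pos_neq0; lra.
  have -> : (1 + y)^-1 ^+ n = (1 + y)^-1 ^+ (n - k) * (1 + y)^-1 ^+ k.
    by rewrite -exprD subnK // -ltnS.
  rewrite (exprMn _ (r * y)); move: (k`!%:R^-1) ((r * y) ^+ k) => f e.
  by move: (_ ^+ k) (_ ^+ (n - k)) => u v; ring.
have u1 : r * (y ^+ 2 / 2) < 1.
  rewrite /y exprVn mulrA -[X in X < _]mulrA -invfM ltr_pdivrMr ?mul1r; nra.
set u := r * (y ^+ 2 / 2) in u1.
have u0 : 0 <= u by rewrite /u; nra.
have le_exp : shift_ratio n <= expR u.
  rewrite sumE; apply: (@le_trans _ _ ((1 + y)^-1 ^+ n * expR (r * y))).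
    rewrite ler_wpM2l ?exp_partial_sum_le // ?mulr_ge0 ?ltW //; last by lra.
    by rewrite exprn_gt0 // invr_gt0; lra.
  have -> : (1 + y)^-1 = expR (- ln (1 + y)).
    by rewrite expRN lnK // posrE; lra.
  rewrite -expRM_natl -expRD ler_expR -rE -mulrDr ler_wpM2l //; first by lra.
  by have := ln1D_ge (ltW y0); lra.
have : expR u <= (1 - u)^-1.
  rewrite -[expR u]invrK lef_pV2 ?posrE ?subr_gt0 ?invr_gt0 ?expR_gt0 //.
  by rewrite -expRN -[1 - u]/(1 + - u) expR_ge1Dx.
have -> : r / (2 * (r - 2) ^+ 2 - r) = (1 - u)^-1 - 1.
  rewrite /u /y; field; do ?[apply/andP; split]; apply: pos_neq0; nra.
lra.
Qed.

End FlatShift.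

Lemma epsilon_gt0 (R : realType) n : (4 <= n)%N -> 0 < epsilon R n.
Proof.
rewrite /epsilon leq_eqVlt eq_sym; case: eqP => [_ _|_ /= n5]; first by lra.
have : 5 <= n%:R :> R by rewrite (ler_nat R 5).
move: (n%:R : R) => r r5.
set D := (r - 1) * _; have D2 : 2 * r ^+ 2 < D.
  (* In [s] the difference is 2 s^3 + 17 s^2 + 37 s + 2. *)
  rewrite /D -subr_gt0; have [s s0 ->] : exists2 s, 0 <= s & r = s + 5.
    by exists (r - 5); rewrite ?subrK //; lra.
  by have := mulr_ge0 s0 s0; have := mulr_ge0 s0 (mulr_ge0 s0 s0); nra.
have r2 : 0 < r ^+ 2 by apply: exprn_gt0; lra.
have D0 : 0 < D by lra.
rewrite subr_gt0 ltr_pdivrMr // mulrAC ltr_pdivlMr; last by lra.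
by rewrite mul1r mulrC -mulrA -expr2.
Qed.

Lemma epsilon_le (R : realType) n : (4 <= n)%N ->
  epsilon R n <= vdw_gain R n.-1 - (shift_ratio R n - 1) / (n%:R - 1).
Proof.
rewrite /epsilon /vdw_gain; case: eqP => [-> _|/eqP n4 n_ge4].
  (* Equality holds: 7/48 - (31/81)/3 = 71/3888. *)
  by rewrite shift_ratio4 /= le_eqVlt; apply/orP; left; apply/eqP; field.
have n5 : (5 <= n)%N by rewrite ltn_neqAle eq_sym n4.
rewrite prednK; last exact: leq_trans n5.
have := shift_ratio_le R n5; move: (shift_ratio R n - 1) => G.
have : 5 <= n%:R :> R by rewrite (ler_nat R 5).
move: (n%:R : R) => r r5 leG.
(* From 5 on, the cubic part of the gain is given away. *)
have gain : 1 / (2 * r) <= (1 + 2 / (3 * r)) / (2 * r).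
  by rewrite ler_pM2r ?invr_gt0 ?lerDl ?divr_ge0 //; lra.
have : G / (r - 1) <= r / (2 * (r - 2) ^+ 2 - r) / (r - 1).
  by rewrite ler_pM2r // invr_gt0; lra.
rewrite -[r / _ / _]mulrA -invfM [_ * (r - 1)]mulrC; lra.
Qed.

Theorem mainTheorem3 (R : realType) :
  (forall n : nat, (4 <= n)%N -> 0 < epsilon R n) /\
  (forall n : nat, (4 <= n)%N ->
   forall A : 'M[R]_n, doubly_stochastic A ->
     permanent A - permanent (marcus_minc A) >=
       n`!%:R / n%:R ^+ n * epsilon R n * frobenius_norm (A - flat_mx R n) ^+ 2).
Proof.
split=> [n|n n4 A dsA]; first exact: epsilon_gt0.
have S_ge0 : 0 <= \sum_i \sum_j (A - flat_mx R n) i j ^+ 2.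
  by apply: sumr_ge0 => i _; apply: sumr_ge0 => j _; apply: sqr_ge0.
rewrite /frobenius_norm sqr_sqrtr //.
have upper := permanent_marcus_minc_le (leq_trans (isT : (1 < 4)%N) n4) dsA.
have lower : n`!%:R / n%:R ^+ n * (1 + vdw_gain R n.-1
    * \sum_i \sum_j (A - flat_mx R n) i j ^+ 2) <= permanent A.
  case: n n4 A dsA {S_ge0 upper} => // N N3 A dsA.
  by apply: permanent_ge_doubly_stochastic => //; apply: (@leq_trans 3).
have C_ge0 : 0 <= n`!%:R / n%:R ^+ n :> R.
  by rewrite divr_ge0 ?exprn_ge0 ?ler0n.
have eps := epsilon_le R n4.
move: (\sum_i _) (n`!%:R / _) S_ge0 C_ge0 upper lower.
move=> S C S_ge0 C_ge0 upper lower.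
have le_eps : C * (S * epsilon R n)
    <= C * (S * (vdw_gain R n.-1 - (shift_ratio R n - 1) / (n%:R - 1))).
  by rewrite !ler_wpM2l.
rewrite -mulrA [epsilon R n * S]mulrC; apply: le_trans le_eps _.
have -> : C * (S * (vdw_gain R n.-1 - (shift_ratio R n - 1) / (n%:R - 1)))
   = C * (1 + vdw_gain R n.-1 * S)
     - C * (1 + S / (n%:R - 1) * (shift_ratio R n - 1)) by ring.
exact: lerB.
Qed.
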